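(* Let $M$ be a monoid, let $G_L$, $G_R$ and $G$ be its sets of left units, right units and (two-sided) units, let $E=\langle E(M)\rangle$ be the subsemigroup generated by the set $E(M)$ of all idempotents of $M$, and let $F=\langle E(M)\cup G\rangle$. Suppose that $G_L\neq G$ (or, equivalently, that $G_R\neq G$). Then: (i) if $M=\langle U\rangle$, then $U\setminus F$ contains at least one element from $G_L\setminus G$, and at least one from $G_R\setminus G$; (ii) $\operatorname{rank}(M:G)\geq2$; (iii) $\operatorname{rank}(M:E)\geq2$; (iv) $\operatorname{rank}(M:F)\geq2$.
   Context: An element $x$ of a monoid $M$ is a left unit if $ax=1$ for some $a\in M$, a right unit if $xb=1$ for some $b\in M$, and a (two-sided) unit if it is both a left unit and a right unit. For a subset $U$ of a semigroup $S$, $\langle U\rangle$ denotes the subsemigroup of $S$ generated by $U$. For $A\subseteq S$, the relative rank of $S$ modulo $A$ is $\operatorname{rank}(S:A)=\min\{|U| : U\subseteq S,\ S=\langle A\cup U\rangle\}$. *)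

(* Defs.v *)
From mathcomp Require Import all_boot.
From mathcomp Require Import boolp classical_sets functions cardinality.

Set Implicit Arguments.
Unset Strict Implicit.
Unset Printing Implicit Defensive.

Local Open Scope classical_set_scope.
Local Open Scope card_scope.
Local Open Scope group_scope.

(* Any nonempty family of sets has a member of least cardinality. By Zorn, take
   a maximal set X of choice functions for the family that pairwise differ on
   every member: X exhausts some member B, and B then injects in all others. *)
Lemma least_card (T : Type) (C : set (set T)) :
  C !=set0 -> exists2 A, C A & forall B, C B -> A #<= B.
Proof.
move=> [C0 CC0].
pose P (X : set (set T -> T)) :=
  (forall f B, X f -> C B -> B (f B)) /\
  (forall f g B, X f -> X g -> C B -> f B = g B -> f = g).
have [F FP Ftot|X [[XC Xinj] Xmax]] := @Zorn_bigcup _ P.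
  split=> [f B [X FX Xf]|f g B [X FX Xf] [Y FY Yg]].
    exact: (FP _ FX).1.
  have [XY|YX] := Ftot _ _ FX FY.
    by apply: (FP _ FY).2 => //; apply: XY.
  by apply: (FP _ FX).2 => //; apply: YX.
have [[B CB XB]|noB] :=
  pselect (exists2 B, C B & forall b, B b -> exists2 f, X f & f B = b).
  exists B => // D CD.
  have /choice[h hP] (b : B) : exists f, X f /\ f B = \val b.
    by have [f] := XB _ (set_mem (valP b)); exists f.
  have hD b : h b D \in D by exact: mem_set (XC _ _ (hP b).1 CD).
  apply/asboolP.
  have hfun : set_fun [set: B] [set: D] (fun b => SigSub (hD b)) by [].
  have hinj : set_inj [set: B] (fun b => SigSub (hD b)).
    move=> b c _ _ /(congr1 \val)/= hbc; apply: val_inj.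
    have [Xb <-] := hP b; have [Xc <-] := hP c.
    by rewrite (Xinj _ _ D Xb Xc CD hbc).
  by apply/injfunPex; exists (fun b => SigSub (hD b)).
have fresh B : C B -> exists b, B b /\ forall f, X f -> f B <> b.
  move=> CB; apply: contrapT => nb; apply: noB; exists B => // b Bb.
  apply: contrapT => nf; apply: nb; exists b; split=> // f Xf fb.
  by apply: nf; exists f.
have [t0 _] := fresh _ CC0.
have /choice[g gP] B : exists b, C B -> B b /\ forall f, X f -> f B <> b.
  by have [/fresh[b]|nCB] := pselect (C B); [exists b|exists t0].
have Xg : ~ X g by move=> Xg; exact: (gP _ CC0).2 Xg erefl.
exfalso; apply: (Xmax (X `|` [set g])).
  by split; [move=> f; left|move=> /(_ g) XgX; apply/Xg/XgX; right].
split=> [f B [/XC XfC|->] CB|f f' B]; [exact: XfC|exact: (gP _ CB).1|].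
move=> [Xf|->] [Xf'|->] CB //; first exact: Xinj.
  by move=> fg; case: ((gP _ CB).2 _ Xf).
by move=> gf; case: ((gP _ CB).2 _ Xf').
Qed.

Section Semigroups.
Variable S : semigroupType.
Implicit Types A U V : set S.

Definition mul_stable A := forall x y, A x -> A y -> A (x * y).

(* The empty set is a subsemigroup here, so it generates itself. *)
Definition gen_subsemigroup A : set S := smallest mul_stable A.

Definition idempotents : set S := [set x | x * x = x].

Definition generates_modulo A : set (set S) :=
  [set U | [set: S] = gen_subsemigroup (A `|` U)].

Lemma generates_modulo_nonempty A : generates_modulo A !=set0.
Proof.
exists [set: S]; apply/seteqP; split=> // x _.
by apply: sub_gen_smallest; right.
Qed.

(* The cardinal rank(S : A), possibly infinite, is represented by a set that
   has this cardinality; it is only meaningful up to #=. *)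
Definition relative_rank A : set S :=
  sval (cid2 (least_card (generates_modulo_nonempty A))).

Lemma relative_rankP A :
  generates_modulo A (relative_rank A) /\
  forall U, generates_modulo A U -> relative_rank A #<= U.
Proof. by rewrite /relative_rank; case: cid2. Qed.

End Semigroups.

Section Units.
Variable M : monoidType.

Definition left_units : set M := [set x | exists a, a * x = 1].
Definition right_units : set M := [set x | exists b, x * b = 1].
Definition units : set M := left_units `&` right_units.

End Units.

Arguments idempotents S : clear implicits.
Arguments left_units M : clear implicits.
Arguments right_units M : clear implicits.
Arguments units M : clear implicits.

(* Main.v *)
Require Import Defs.
From mathcomp Require Import all_boot.
From mathcomp Require Import boolp classical_sets functions cardinality.
Local Open Scope classical_set_scope.
Local Open Scope card_scope.

(** Call a left unit strict if it is not a unit. A product of elements that are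
    not strict left units is not a strict left unit either: if [x * y] is a
    left unit, then so is its last factor [y], which is therefore a unit and
    can be cancelled; so [x] is a left unit as well, hence a unit, and so is
    [x * y]. In other words [~` (GL `\` G)] is a subsemigroup
    ([nonstrict_left_stable]), and by symmetry so is [~` (GR `\` G)].

    The only idempotent left (or right) unit is [1], so both subsemigroups
    contain the idempotents and the units, hence [F]. If a generating set [U]
    met [GL `\` G] only inside [F], it would be contained in [~` (GL `\` G)],
    which would then be all of [M]: this gives (i).

    For the ranks, let [A] be contained in [F] and let [A `|` U] generate [M].
    The elements of [GL `\` G] and [GR `\` G] provided by (i) lie outside [F],
    hence in [U], and they differ because [GL `&` GR = G]
    ([two_le_relative_rank]). *)

Lemma two_le_card (T : Type) (A : set T) (a b : T) :
  A a -> A b -> a <> b -> `I_2 #<= A.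
Proof.
move=> Aa Ab ab; pose f (i : nat) := if i == 0%N then a else b.
have finj : {in `I_2 &, injective f}.
  move=> [|[|i]] [|[|j]]; rewrite !inE //= => _ _; rewrite /f /= => eq_f //.
  by case: ab.
rewrite -(card_le_eql (inj_card_eq finj)); apply: subset_card_le.
by move=> _ [i _ <-]; rewrite /f; case: ifP.
Qed.

Section OneSidedUnits.
Set Implicit Arguments.
Unset Strict Implicit.
Context {M : monoidType}.
Local Open Scope group_scope.
Implicit Types (x y : M) (U A : set M).

Let GL := left_units M.
Let GR := right_units M.
Let G := units M.
Let F := gen_subsemigroup (idempotents M `|` G).

Lemma unit_inverse x : G x -> exists2 y, y * x = 1 & x * y = 1.
Proof.
move=> [[a ax] [b xb]]; exists b => //.
by rewrite -[b]mul1g -ax -[a * x * b]mulgA xb mulg1.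
Qed.

Lemma left_unitM x y : GL x -> GL y -> GL (x * y).
Proof.
by move=> [a ax] [b yb]; exists (b * a); rewrite -mulgA (mulgA a) ax mul1g.
Qed.

Lemma right_unitM x y : GR x -> GR y -> GR (x * y).
Proof.
by move=> [a xa] [b yb]; exists (b * a); rewrite -mulgA (mulgA y) yb mul1g.
Qed.

Lemma unitM x y : G x -> G y -> G (x * y).
Proof.
by move=> [xL xR] [yL yR]; split; [exact: left_unitM|exact: right_unitM].
Qed.

(** The left inverses of left units are exactly the right units, and a left
    unit is a unit as soon as one of its left inverses is. *)
Lemma left_units_neq_right : GL <> G <-> GR <> G.
Proof.
split=> neq eqG; apply: neq; apply/seteqP; split=> [x|x []] //.
- move=> [a ax]; have : GR a by exists x.
  rewrite eqG => /unit_inverse[c ca ac].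
  split; [by exists a|exists a].
  by rewrite -[x]mul1g -ca -[c * a * x]mulgA ax mulg1.
- move=> [b xb]; have : GL b by exists x.
  rewrite eqG => /unit_inverse[c cb bc].
  split; [exists b|by exists b].
  by rewrite -[x]mulg1 -bc [x * _]mulgA xb mul1g.
Qed.

(** If [x * y] is a left unit, then so is [y], which lies outside [GL `\` G]
    and thus is invertible; cancelling it puts [x] in [GL], hence in [G]. *)
Lemma nonstrict_left_stable : mul_stable (~` (GL `\` G)).
Proof.
move=> x y nx ny [[a axy] nxy].
have yG : G y.
  apply: contrapT => nGy; apply: ny; split=> //.
  by exists (a * x); rewrite -mulgA.
have [b by1 yb] := unit_inverse yG.
apply: nx; split=> [|xG]; last by apply: nxy; exact: unitM.
(* A left inverse of a unit is its inverse. *)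
have axb : a * x = b.
  by rewrite -[LHS]mulg1 -yb mulgA -[a * x * y]mulgA axy mul1g.
by exists (y * a); rewrite -mulgA axb.
Qed.

Lemma nonstrict_right_stable : mul_stable (~` (GR `\` G)).
Proof.
move=> x y nx ny [[b xyb] nxy].
have xG : G x.
  apply: contrapT => nGx; apply: nx; split=> //.
  by exists (y * b); rewrite mulgA.
have [a ax xa] := unit_inverse xG.
apply: ny; split=> [|yG]; last by apply: nxy; exact: unitM.
have yba : y * b = a.
  by rewrite -[LHS]mul1g -ax -mulgA [x * (y * b)]mulgA xyb mulg1.
by exists (b * x); rewrite mulgA yba.
Qed.

Lemma idempotent_left_unit x : x * x = x -> GL x -> x = 1.
Proof. by move=> xx [a ax]; rewrite -[x]mul1g -ax -mulgA xx. Qed.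

Lemma idempotent_right_unit x : x * x = x -> GR x -> x = 1.
Proof. by move=> xx [b xb]; rewrite -[x]mulg1 -xb mulgA xx. Qed.

Lemma unit1 : G 1.
Proof. by split; exists 1; rewrite mulg1. Qed.

Lemma sub_nonstrict_left : F `<=` ~` (GL `\` G).
Proof.
apply: smallest_sub; first exact: nonstrict_left_stable.
move=> x [xx|xG] [xL nxG]; last exact: nxG.
by apply: nxG; rewrite (idempotent_left_unit xx xL); exact: unit1.
Qed.

Lemma sub_nonstrict_right : F `<=` ~` (GR `\` G).
Proof.
apply: smallest_sub; first exact: nonstrict_right_stable.
move=> x [xx|xG] [xR nxG]; last exact: nxG.
by apply: nxG; rewrite (idempotent_right_unit xx xR); exact: unit1.
Qed.

(** Otherwise [U], hence all that it generates, would lie in the proper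
    subsemigroup [T]. *)
Lemma generators_meet (T B U : set M) : mul_stable T -> B `<=` T ->
  T <> [set: M] -> [set: M] = gen_subsemigroup U ->
  ((U `\` B) `&` ~` T) !=set0.
Proof.
move=> Tmul BT Tproper genU; apply: contrapT => noU; apply: Tproper.
apply/seteqP; split=> //; rewrite genU; apply: smallest_sub => // u Uu.
by apply: contrapT => nTu; apply: noU; exists u; split=> //; split=> // /BT.
Qed.

Lemma setD_unitsC_proper (B : set M) :
  G `<=` B -> B <> G -> ~` (B `\` G) <> [set: M].
Proof.
move=> GB neq eqT; apply: neq; apply/seteqP; split=> // x Bx.
apply: contrapT => nGx.
have : [set: M] x by [].
by rewrite -eqT; apply.
Qed.

Lemma generators_strict_units U : GL <> G -> [set: M] = gen_subsemigroup U ->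
  ((U `\` F) `&` (GL `\` G)) !=set0 /\ ((U `\` F) `&` (GR `\` G)) !=set0.
Proof.
move=> neqL genU; have neqR := left_units_neq_right.1 neqL.
split; [rewrite -[GL `\` G]setCK|rewrite -[GR `\` G]setCK].
- apply: generators_meet genU; [exact: nonstrict_left_stable|
    exact: sub_nonstrict_left|].
  by apply: setD_unitsC_proper => // x [].
- apply: generators_meet genU; [exact: nonstrict_right_stable|
    exact: sub_nonstrict_right|].
  by apply: setD_unitsC_proper => // x [].
Qed.

Lemma two_le_relative_rank A : GL <> G -> A `<=` F -> `I_2 #<= relative_rank A.
Proof.
move=> neq AF.
have [gen _] := relative_rankP A.
have [[u [[uAU nFu] [uL nuG]]] [v [[vAU nFv] [vR nvG]]]] :=
  generators_strict_units neq gen.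
have inU w : (A `|` relative_rank A) w -> ~ F w -> relative_rank A w.
  by move=> [/AF|].
apply: (two_le_card _ _ u v (inU _ uAU nFu) (inU _ vAU nFv)) => uv.
by apply: nuG; split=> //; rewrite uv.
Qed.

End OneSidedUnits.

Theorem lemma2p11 (M : monoidType) :
  let GL := left_units M in
  let GR := right_units M in
  let G := units M in
  let E := gen_subsemigroup (idempotents M) in
  let F := gen_subsemigroup (idempotents M `|` G) in
  (GL <> G <-> GR <> G) /\
  (GL <> G ->
    [/\ forall U : set M, [set: M] = gen_subsemigroup U ->
          ((U `\` F) `&` (GL `\` G)) !=set0 /\
          ((U `\` F) `&` (GR `\` G)) !=set0,
        `I_2 #<= relative_rank G,
        `I_2 #<= relative_rank E
      & `I_2 #<= relative_rank F]).
Proof.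
move=> GL GR G E F; split; first exact: left_units_neq_right.
move=> neq; split; first by move=> U; exact: generators_strict_units.
- by apply: two_le_relative_rank => // x xG; apply: sub_gen_smallest; right.
- apply: two_le_relative_rank => // x xE C [Cmul].
  by rewrite subUset => -[idC _]; exact: xE.
- exact: two_le_relative_rank.
Qed.
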